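(* For all integers $b,b'$ with $2\leq b<b'$, we have $s_b<s_{b'}$.
   Context: For an integer $b\geq 2$, a positive integer $n$ with base-$b$ expansion $n=(a_ka_{k-1}\cdots a_0)_b=\sum_{i=0}^k a_i b^i$, where $0\leq a_i\leq b-1$ and $a_k\neq 0$, is a $b$-adic palindrome if $a_{k-i}=a_i$ for all $0\leq i\leq k$. Let $P_b$ be the set of all $b$-adic palindromes, and define $s_b=\sum_{n\in P_b}\frac1n$ (this series converges). *)

(* Defs.v *)
From HB Require Import structures.
From mathcomp Require Import all_boot all_order all_algebra.
From mathcomp Require Import all_classical all_reals all_analysis.

Set Implicit Arguments.
Unset Strict Implicit.
Unset Printing Implicit Defensive.

Import Order.TTheory GRing.Theory Num.Theory.

Local Open Scope classical_set_scope.
Local Open Scope nat_scope.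

(* n = (a_k ... a_0)_b with leading digit a_k <> 0; the values of [a] beyond
   k are irrelevant. *)
Definition is_expansion (b n k : nat) (a : nat -> nat) : Prop :=
  [/\ forall i, i <= k -> a i <= b - 1,
      a k <> 0 &
      n = \sum_(i < k.+1) a i * b ^ i].

Definition palindrome (b n : nat) : Prop :=
  0 < n /\ exists (k : nat) (a : nat -> nat),
    is_expansion b n k a /\ forall i, i <= k -> a (k - i) = a i.

Definition palindromes (b : nat) : set nat := [set n | palindrome b n].

(* The terms are nonnegative, so the sum over the set of palindromes always
   makes sense in \bar R; it is the usual sum of the series (whose convergence
   means that the value is not +oo). *)
Definition palindrome_sum (R : realType) (b : nat) : \bar R :=
  (\esum_(n in palindromes b) ((n%:R : R)^-1)%:E)%R.

(* Main.v *)
(* A palindrome is determined by its leading half x, and x ranges over all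
   positive integers, once for odd and once for even lengths.  If x has t+1
   digits, the palindrome lies in [x b^m, (x+1) b^m) with m = t for odd length
   and m = t+1 for even length.  Let
     U_t = sum of 1/x over b^t <= x < b^(t+1),
     V_t = sum of 1/(x+1) over the same range.
   Then U_t decreases and V_t increases with t, so that, H being the sum U_0 of
   the reciprocals of the digits, summing geometric series gives
     V_1 (b+1)/(b(b-1)) <= s_b - H (1 + 1/(b+1)) <= U_1 (b+1)/(b(b-1)).
   The quantity V_1 for b+1 is at least U_1 - 1/(b(b+1)) for b, and for b >= 4
   the bounds U_1 <= H <= (3b+10)/12 then suffice to separate s_b from s_(b+1).
   The bounds are evaluated directly for b = 3, and for b = 2 after splitting
   off the palindromes with at most four digits. *)
Require Import Defs.
From mathcomp Require Import all_boot all_order all_algebra.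
From mathcomp Require Import all_classical all_reals all_analysis.
From mathcomp Require Import zify ring lra.

Set Implicit Arguments.
Unset Strict Implicit.
Unset Printing Implicit Defensive.

Import Order.TTheory GRing.Theory Num.Theory.

Local Open Scope nat_scope.

(** * Digits and expansions in base b *)

Definition digit b x j := x %/ b ^ j %% b.

Lemma expansion_lt b n (a : nat -> nat) : (forall i, i < n -> a i < b) ->
  \sum_(i < n) a i * b ^ i < b ^ n.
Proof.
elim: n => [|n IHn] ab; first by rewrite big_ord0.
rewrite big_ord_recr /=.
apply: (@leq_trans (b ^ n + a n * b ^ n)).
  by rewrite ltn_add2r IHn // => i lt_in; apply/ab/leqW.
by rewrite -mulSn expnS leq_mul2r ab ?orbT.
Qed.

Lemma expansionS b n (a : nat -> nat) :
  \sum_(i < n.+1) a i * b ^ i = a 0 + b * \sum_(i < n) a i.+1 * b ^ i.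
Proof.
rewrite big_ord_recl muln1 big_distrr /=; congr addn.
by apply: eq_bigr => i _; rewrite /bump /= add1n expnS mulnCA.
Qed.

Lemma digit_expansion b n (a : nat -> nat) j :
    (forall i, i < n -> a i < b) -> j < n ->
  digit b (\sum_(i < n) a i * b ^ i) j = a j.
Proof.
elim: j n a => [|j IHj] [|n] a ab // lt_jn; rewrite expansionS /digit.
  by rewrite divn1 addnC mulnC modnMDl modn_small ?ab.
have b_gt0 : 0 < b by apply: leq_ltn_trans (ab 0 _).
rewrite expnS divnMA addnC mulnC divnMDl // (divn_small (ab 0 _)) // ?addn0.
by apply: (IHj n (fun i => a i.+1)) => // i lt_in; apply: ab.
Qed.

Lemma expansion_digit b x n : 0 < b -> x < b ^ n ->
  \sum_(i < n) digit b x i * b ^ i = x.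
Proof.
move=> b_gt0; elim: n x => [|n IHn] x ltx.
  by rewrite big_ord0; case: x ltx.
rewrite expansionS /digit divn1 [RHS](divn_eq x b) addnC mulnC; congr (_ * _ + _).
rewrite -[RHS]IHn; last by rewrite ltn_divLR // -expnSr.
by apply: eq_bigr => i _; rewrite /digit expnS divnMA.
Qed.

(** * Palindromes as mirrored leading halves *)

Definition half_length b (e : bool) x := trunc_log b x + e.

(* The palindrome with leading half [x]: [x] is followed by its reversal, the
   last digit of [x] being shared by the two halves when [e = false] and
   repeated when [e = true]. *)
Definition mirror b e x :=
  x * b ^ half_length b e x +
  \sum_(i < half_length b e x) digit b x (trunc_log b x - i) * b ^ i.

Lemma mirror_bounds b e x : 1 < b ->
  x * b ^ half_length b e x <= mirror b e x < x.+1 * b ^ half_length b e x.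
Proof.
move=> b_gt1; rewrite /mirror leq_addr mulSn addnC ltn_add2r.
apply: (@expansion_lt b _ (fun i => digit b x (trunc_log b x - i))) => i _.
by rewrite ltn_mod ltnW.
Qed.

Lemma mirror_gt0 b e x : 1 < b -> 0 < x -> 0 < mirror b e x.
Proof.
move=> b_gt1 x_gt0; have /andP[/(leq_trans _)-> //] := mirror_bounds e x b_gt1.
by rewrite muln_gt0 x_gt0 expn_gt0 ltnW.
Qed.

Lemma divn_mirror b e x : 1 < b -> mirror b e x %/ b ^ half_length b e x = x.
Proof.
move=> b_gt1; have := mirror_bounds e x b_gt1.
set p := _ ^ _ => bnd; have p_gt0 : 0 < p by rewrite expn_gt0 ltnW.
by apply/eqP; rewrite eqn_leq -ltnS ltn_divLR // leq_divRL // andbC.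
Qed.

Lemma trunc_log_mirror b e x : 1 < b -> 0 < x ->
  trunc_log b (mirror b e x) = (trunc_log b x).*2 + e.
Proof.
move=> b_gt1 x_gt0; apply: trunc_log_eq => //.
have /andP[lx xl] := trunc_log_bounds b_gt1 x_gt0.
have /andP[lm ml] := mirror_bounds e x b_gt1.
rewrite -addnn -addnA -addnS expnD -[_ + e]/(half_length b e x).
rewrite (leq_trans _ lm) ?leq_mul2r ?lx ?orbT //=.
rewrite (leq_trans ml) // -addSnnS expnD leq_mul2r xl orbT //.
Qed.

(** The truncated logarithm of the palindrome is 2t + e, where t is that of x. Its parity gives [e],
    hence t and the length of the lower part; dividing that part off leaves x. *)
Lemma mirror_inj b e e' x x' : 1 < b -> 0 < x -> 0 < x' ->
  mirror b e x = mirror b e' x' -> e = e' /\ x = x'.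
Proof.
move=> b_gt1 x_gt0 x'_gt0 eqm.
have := trunc_log_mirror e b_gt1 x_gt0.
rewrite eqm trunc_log_mirror // => eqt.
have eqe : e = e' by have := congr1 odd eqt; rewrite !oddD !odd_double !oddb.
have eqh : half_length b e x = half_length b e' x'.
  rewrite /half_length; move: eqt; rewrite eqe; lia.
by split=> //; rewrite -(divn_mirror e x b_gt1) eqm eqh divn_mirror.
Qed.

Lemma palindrome_mirror b e x : 1 < b -> 0 < x -> palindrome b (mirror b e x).
Proof.
move=> b_gt1 x_gt0; split; first exact: mirror_gt0.
set t := trunc_log b x; set m := half_length b e x.
have em : m = t + e by [].
(* Digits are listed from the least significant one: first the [m] reversed digits, then x
   itself. *)
pose a i := if i < m then digit b x (t - i) else digit b x (i - m).
have b_gt0 := ltnW b_gt1.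
have dlt j : digit b x j < b by rewrite ltn_mod.
have /andP[lx xl] : b ^ t <= x < b ^ t.+1 by apply: trunc_log_bounds.
exists (m + t), a; split; [split|].
- by move=> i _; rewrite /a; case: ifP => _; rewrite leq_subRL // add1n dlt.
- rewrite /a ltnNge leq_addr /= addKn /digit modn_small.
    by apply/eqP; rewrite -lt0n divn_gt0 ?expn_gt0 ?b_gt0.
  by rewrite ltn_divLR ?expn_gt0 ?b_gt0 // -expnS.
- rewrite -addnS big_split_ord /= /mirror addnC -/m -/t; congr addn.
    by apply: eq_bigr => i _; rewrite /a ltn_ord.
  rewrite -{1}(expansion_digit b_gt0 xl) big_distrl /=; apply: eq_bigr => i _.
  by rewrite /a ltnNge leq_addr /= addKn expnD mulnAC mulnA.
- move=> i le_i; rewrite /a.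
  by case: ltnP => lt1; case: ltnP => lt2; congr digit; lia.
Qed.

Lemma palindrome_is_mirror b n : 1 < b -> palindrome b n ->
  exists e x, 0 < x /\ n = mirror b e x.
Proof.
move=> b_gt1 [n_gt0 [k [a [[ab /eqP ak0 def_n] a_sym]]]].
have b_gt0 := ltnW b_gt1.
have alt i : i <= k -> a i < b by move=> /ab; lia.
pose e := odd k; pose t := k./2.
have def_k : k = t + e + t by rewrite /e /t; have := odd_double_half k; lia.
(* The leading half consists of the top t + 1 digits; symmetry recovers the remaining t + e low
   digits from them. *)
pose c i := a (t + e + i).
pose x := \sum_(i < t.+1) c i * b ^ i.
have clt i : i < t.+1 -> c i < b by move=> ?; apply: alt; lia.
have ct_gt0 : 0 < c t by rewrite /c -def_k lt0n.
have bx : b ^ t <= x < b ^ t.+1.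
  rewrite expansion_lt // andbT /x big_ord_recr /=.
  by rewrite (leq_trans _ (leq_addl _ _)) // leq_pmull.
have tx := trunc_log_eq b_gt1 bx.
exists e, x; split; first by case/andP: bx => /(leq_trans _)->; rewrite ?expn_gt0 ?b_gt0.
rewrite /mirror /half_length tx def_n def_k -addnS big_split_ord /= addnC.
congr addn.
  rewrite /x big_distrl; apply: eq_bigr => i _.
  by rewrite /= expnD mulnCA mulnC.
apply: eq_bigr => i _; congr (_ * _).
have lti := ltn_ord i.
rewrite digit_expansion //; last lia.
rewrite /c -a_sym; last lia.
congr a; have := leq_b1 e; lia.
Qed.

Local Open Scope classical_set_scope.
Local Open Scope ring_scope.

(** * The palindrome sum as a series over leading halves *)

Definition mirror_term (R : realType) b x : R :=
  (mirror b false x)%:R^-1 + (mirror b true x)%:R^-1.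

Lemma mirror_term_ge0 (R : realType) b x : 0 <= mirror_term R b x.
Proof. by rewrite addr_ge0 ?invr_ge0. Qed.

Lemma mirror0 b e : mirror b e 0 = 0%N.
Proof.
by rewrite /mirror big1 // => i _; rewrite /digit div0n mod0n.
Qed.

(** Palindromes split by parity of length into two disjoint classes, each an injective image of the
    positive integers under [mirror b e]. *)
Lemma palindrome_sum_mirror (R : realType) b : (1 < b)%N ->
  palindrome_sum R b = (\sum_(x <oo) (mirror_term R b x)%:E)%E.
Proof.
move=> b_gt1; set P : set nat := [set x | (0 < x)%N].
have inv_ge0 n : (0 <= (n%:R^-1 : R)%:E)%E by rewrite lee_fin invr_ge0.
have inj e : set_inj P (mirror b e).
  by move=> x y; rewrite !inE => /= x0 y0 /(mirror_inj b_gt1 x0 y0)[].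
have Ef : palindromes b `&` (mirror b false @` P) = mirror b false @` P.
  apply/setIidr => _ [x x_gt0 <-]; exact: palindrome_mirror.
have Et : palindromes b `&` ~` (mirror b false @` P) = mirror b true @` P.
  rewrite predeqE => n; split=> [[pal_n notf]|[x x_gt0 <-]]; last first.
    split; first exact: palindrome_mirror.
    by move=> [y y_gt0 /(mirror_inj b_gt1 y_gt0 x_gt0)[]].
  have [[] [x [x_gt0 def_n]]] := palindrome_is_mirror b_gt1 pal_n.
    by exists x.
  by case: notf; exists x.
rewrite /palindrome_sum (esumID (mirror b false @` P)) // Ef Et.
rewrite !esum_image // -esumD //.
rewrite (eq_esum (b := fun x => (mirror_term R b x)%:E)) //.
rewrite nneseries_esumT; last by move=> x; rewrite lee_fin mirror_term_ge0.
rewrite esum_mkcond; apply: eq_esum => x _; case: ifPn => // /negP notP.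
(* The index x = 0 is harmless: its mirrors are 0, and the inverse of 0 is 0. *)
rewrite /mirror_term; case: x notP => [|x] notP; first by rewrite !mirror0 invr0 addr0.
by case: notP; rewrite inE.
Qed.

Definition block (R : realType) b e t : R :=
  \sum_((b ^ t)%N <= x < (b ^ t.+1)%N) (mirror b e x)%:R^-1.

Definition partial_sum (R : realType) b N : R :=
  \sum_(0 <= t < N) (block R b false t + block R b true t).

Lemma partial_sumE (R : realType) b N : (0 < b)%N ->
  \sum_(0 <= x < (b ^ N)%N) mirror_term R b x = partial_sum R b N.
Proof.
move=> b_gt0; elim: N => [|N IHN].
  by rewrite expn0 big_nat1 /partial_sum big_nil /mirror_term !mirror0 invr0 addr0.
rewrite /partial_sum big_nat_recr //= -/(partial_sum R b N) -IHN.
by rewrite (big_cat_nat (n := (b ^ N)%N)) ?leq_pexp2l //= /block -big_split.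
Qed.

(** Since n < b^n and the terms are nonnegative, every partial sum of the series is dominated by one
    that stops at a large power of b. *)
Lemma palindrome_sum_le (R : realType) b (c : R) M : (1 < b)%N ->
  (forall N, (M <= N)%N -> partial_sum R b N <= c) ->
  (palindrome_sum R b <= c%:E)%E.
Proof.
move=> b_gt1 le_c; rewrite palindrome_sum_mirror //; apply: lime_le.
  by apply: is_cvg_nneseries => x _ _; rewrite lee_fin mirror_term_ge0.
apply: nearW => n; rewrite sumEFin lee_fin.
have le_n : (n <= b ^ (maxn n M))%N.
  by rewrite (leq_trans (leq_maxl n M)) // ltnW // ltn_expl.
apply: le_trans (le_c (maxn n M) (leq_maxr _ _)).
rewrite -partial_sumE ?(ltnW b_gt1) // [leRHS](big_cat_nat (n := n)) //=.
by rewrite lerDl sumr_ge0 // => i _; apply: mirror_term_ge0.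
Qed.

Lemma le_palindrome_sum (R : realType) b N : (1 < b)%N ->
  ((partial_sum R b N)%:E <= palindrome_sum R b)%E.
Proof.
move=> b_gt1; rewrite palindrome_sum_mirror // -partial_sumE ?(ltnW b_gt1) //.
rewrite -sumEFin; apply: nneseries_lim_ge => x _ _.
by rewrite lee_fin mirror_term_ge0.
Qed.

(** * Monotonicity of reciprocal sums under dilation *)

Lemma big_nat_addl (R : realType) (F : nat -> R) m k :
  \sum_(m <= i < (m + k)%N) F i = \sum_(0 <= i < k) F (m + i)%N.
Proof.
by rewrite -{1}[m]add0n big_addn addKn; apply: eq_bigr => i _; rewrite addnC.
Qed.

(** Each x on the right corresponds to the b integers bx + i with i < b on the left; their
    reciprocals are at most 1/(bx), so they add up to at most 1/x. *)
Lemma sum_inv_dilate_le (R : realType) b m n : (0 < b)%N -> (0 < m)%N -> (m <= n)%N ->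
  \sum_((b * m)%N <= x < (b * n)%N) (x%:R^-1 : R) <= \sum_(m <= x < n) x%:R^-1.
Proof.
move=> b_gt0 m_gt0; elim: n => [|n IHn]; first by rewrite leqn0 gtn_eqF.
rewrite leq_eqVlt => /orP[/eqP <-|]; first by rewrite !big_geq.
rewrite ltnS => le_mn; rewrite big_nat_recr //=.
rewrite (big_cat_nat (n := (b * n)%N)) ?leq_mul2l ?le_mn ?leqnSn ?orbT //=.
rewrite lerD ?IHn // mulnS addnC big_nat_addl.
have n_gt0 : (0 < n)%N := leq_trans m_gt0 le_mn.
have -> : n%:R^-1 = \sum_(0 <= i < b) ((b * n)%:R^-1 : R).
  rewrite sumr_const_nat subn0 natrM invfM -[RHS]mulr_natr mulrAC mulVf ?mul1r //.
  by rewrite pnatr_eq0 -lt0n.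
apply: ler_sum => i _; rewrite lef_pV2 ?ler_nat ?leq_addr // posrE ltr0n.
  by rewrite addn_gt0 muln_gt0 b_gt0 n_gt0.
by rewrite muln_gt0 b_gt0 n_gt0.
Qed.

(** Dually, bx + i + 1 <= b(x + 1) for i < b, so these b reciprocals add up to at least 1/(x +
    1). *)
Lemma sum_invS_dilate_ge (R : realType) b m n : (0 < b)%N -> (m <= n)%N ->
  \sum_(m <= x < n) (x.+1%:R^-1 : R) <=
  \sum_((b * m)%N <= x < (b * n)%N) x.+1%:R^-1.
Proof.
move=> b_gt0; elim: n => [|n IHn]; first by rewrite leqn0 => /eqP->; rewrite muln0 !big_geq.
rewrite leq_eqVlt => /orP[/eqP <-|]; first by rewrite !big_geq.
rewrite ltnS => le_mn; rewrite big_nat_recr //=.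
rewrite [leRHS](big_cat_nat (n := (b * n)%N)) ?leq_mul2l ?le_mn ?leqnSn ?orbT //=.
rewrite lerD ?IHn // mulnS addnC big_nat_addl.
have -> : n.+1%:R^-1 = \sum_(0 <= i < b) ((b * n.+1)%:R^-1 : R).
  rewrite sumr_const_nat subn0 natrM invfM -[RHS]mulr_natr mulrAC mulVf ?mul1r //.
  by rewrite pnatr_eq0 -lt0n.
apply: ler_sum_nat => i /andP[_ lt_ib]; rewrite lef_pV2 ?posrE ?ltr0n //; last first.
  by rewrite muln_gt0 b_gt0.
by rewrite ler_nat mulnS [(b + _)%N]addnC -addnS leq_add2l.
Qed.

(** This is U_t, with H at t = 0; [invS_sum] is V_t. *)
Definition inv_sum (R : realType) b t : R :=
  \sum_((b ^ t)%N <= x < (b ^ t.+1)%N) x%:R^-1.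

Definition invS_sum (R : realType) b t : R :=
  \sum_((b ^ t)%N <= x < (b ^ t.+1)%N) x.+1%:R^-1.

Lemma inv_sum_antitone (R : realType) b t :
  (0 < b)%N -> inv_sum R b t.+1 <= inv_sum R b t.
Proof.
move=> b_gt0; rewrite /inv_sum (expnS b t.+1) {1}(expnS b t).
by rewrite sum_inv_dilate_le ?expn_gt0 ?b_gt0 // leq_pexp2l.
Qed.

Lemma invS_sum_monotone (R : realType) b t :
  (0 < b)%N -> invS_sum R b t <= invS_sum R b t.+1.
Proof.
move=> b_gt0; rewrite /invS_sum (expnS b t.+1) {2}(expnS b t).
by rewrite sum_invS_dilate_ge // leq_pexp2l.
Qed.

Lemma inv_sum_ge0 (R : realType) b t : 0 <= inv_sum R b t.
Proof. by apply: sumr_ge0 => x _; rewrite invr_ge0. Qed.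

Lemma invS_sum_ge0 (R : realType) b t : 0 <= invS_sum R b t.
Proof. by apply: sumr_ge0 => x _; rewrite invr_ge0. Qed.

Lemma inv_sum_le1 (R : realType) b t : (0 < b)%N -> (0 < t)%N ->
  inv_sum R b t <= inv_sum R b 1.
Proof.
move=> b_gt0; elim: t => [//|[//|t] IHt] _.
exact: le_trans (inv_sum_antitone R _ b_gt0) (IHt isT).
Qed.

Lemma invS_sum_ge1 (R : realType) b t : (0 < b)%N -> (0 < t)%N ->
  invS_sum R b 1 <= invS_sum R b t.
Proof.
move=> b_gt0; elim: t => [//|[//|t] IHt] _.
exact: le_trans (IHt isT) (invS_sum_monotone R _ b_gt0).
Qed.

(** * Block estimates and geometric tails *)

Lemma half_length_block b (e : bool) t x : (1 < b)%N -> (b ^ t <= x < b ^ t.+1)%N ->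
  half_length b e x = (t + e)%N.
Proof. by move=> b_gt1 xt; rewrite /half_length (trunc_log_eq b_gt1 xt). Qed.

Lemma block_le (R : realType) b (e : bool) t : (1 < b)%N ->
  block R b e t <= inv_sum R b t / b%:R ^+ (t + e).
Proof.
move=> b_gt1; have b_gt0 := ltnW b_gt1; rewrite mulr_suml.
apply: ler_sum_nat => x xt.
have x_gt0 : (0 < x)%N by case/andP: xt => /(leq_trans _)->; rewrite ?expn_gt0 ?b_gt0.
have := mirror_bounds e x b_gt1; rewrite (half_length_block e b_gt1 xt) => /andP[lm _].
rewrite -invfM -natrX -natrM lef_pV2 ?ler_nat // posrE ltr0n ?mirror_gt0 //.
by rewrite muln_gt0 x_gt0 expn_gt0 b_gt0.
Qed.

Lemma block_ge (R : realType) b (e : bool) t : (1 < b)%N ->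
  invS_sum R b t / b%:R ^+ (t + e) <= block R b e t.
Proof.
move=> b_gt1; have b_gt0 := ltnW b_gt1; rewrite mulr_suml.
apply: ler_sum_nat => x xt.
have x_gt0 : (0 < x)%N by case/andP: xt => /(leq_trans _)->; rewrite ?expn_gt0 ?b_gt0.
have := mirror_bounds e x b_gt1; rewrite (half_length_block e b_gt1 xt) => /andP[_ /ltnW ml].
rewrite -invfM -natrX -natrM lef_pV2 ?ler_nat // posrE ltr0n ?mirror_gt0 //.
by rewrite muln_gt0 expn_gt0 b_gt0.
Qed.

(** A one-digit half x yields exactly x or x(b + 1). *)
Lemma block0 (R : realType) b (e : bool) : (1 < b)%N ->
  block R b e 0 = inv_sum R b 0 / (b + 1)%:R ^+ e.
Proof.
move=> b_gt1; rewrite mulr_suml; apply: eq_big_nat => x xt.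
rewrite -invfM -natrX -natrM; congr (_%:R^-1).
have xb : (x < b)%N by case/andP: xt; rewrite expn1.
rewrite /mirror (half_length_block e b_gt1 xt) add0n.
case: e; rewrite ?big_ord0 ?big_ord1 ?addn0 // !expn1 mulnDr.
by rewrite /digit (trunc_log_eq b_gt1 xt) expn0 divn1 modn_small.
Qed.

(* The sum over t >= N of w / b^t + w / b^(t+1). *)
Definition tail (R : realType) (w : R) b N : R :=
  w * (b%:R + 1) / ((b%:R - 1) * b%:R ^+ N).

Lemma tailS (R : realType) (w : R) b N : (1 < b)%N ->
  tail w b N = w / b%:R ^+ N + w / b%:R ^+ N.+1 + tail w b N.+1.
Proof.
move=> b_gt1; rewrite /tail !exprS.
have b1 : b%:R - 1 != 0 :> R by rewrite subr_eq0 pnatr_eq1 gtn_eqF.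
have b0 : b%:R != 0 :> R by rewrite pnatr_eq0 -lt0n ltnW.
have bN : b%:R ^+ N != 0 :> R by rewrite expf_neq0.
by field; rewrite b1 b0 bN.
Qed.

Lemma tail_ge0 (R : realType) (w : R) b N : (1 < b)%N -> 0 <= w -> 0 <= tail w b N.
Proof.
move=> b_gt1 w0; by rewrite /tail divr_ge0 ?mulr_ge0 ?exprn_ge0 ?subr_ge0 ?ler1n ?(ltnW b_gt1) ?addr_ge0.
Qed.

Lemma partial_sumS (R : realType) b N :
  partial_sum R b N.+1 = partial_sum R b N + (block R b false N + block R b true N).
Proof. by rewrite /partial_sum big_nat_recr. Qed.

(** Raising N by one adds two blocks, at most w / b^N + w / b^(N+1) with w = U_1, which is exactly
    what the tail loses. The bound U_t <= U_1 requires t >= 1, whence 0 < M. *)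
Lemma partial_sum_le (R : realType) b M N : (1 < b)%N -> (0 < M <= N)%N ->
  partial_sum R b N + tail (inv_sum R b 1) b N <=
  partial_sum R b M + tail (inv_sum R b 1) b M.
Proof.
move=> b_gt1 /andP[M_gt0]; have b_gt0 := ltnW b_gt1.
elim: N => [|N IHN]; first by rewrite leqn0 gtn_eqF.
rewrite leq_eqVlt => /orP[/eqP->//|]; rewrite ltnS => le_MN.
apply: le_trans (IHN le_MN); rewrite partial_sumS (tailS _ N b_gt1) -addrA lerD2l lerD2r.
have le1 := inv_sum_le1 R b_gt0 (leq_trans M_gt0 le_MN).
have := block_le R false N b_gt1; have := block_le R true N b_gt1.
rewrite addn0 addn1 => leT leF; apply: lerD.
  by apply: le_trans leF _; rewrite ler_wpM2r // invr_ge0 exprn_ge0.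
by apply: le_trans leT _; rewrite ler_wpM2r // invr_ge0 exprn_ge0.
Qed.

Lemma partial_sum_ge (R : realType) b M N : (1 < b)%N -> (0 < M <= N)%N ->
  partial_sum R b M + tail (invS_sum R b 1) b M <=
  partial_sum R b N + tail (invS_sum R b 1) b N.
Proof.
move=> b_gt1 /andP[M_gt0]; have b_gt0 := ltnW b_gt1.
elim: N => [|N IHN]; first by rewrite leqn0 gtn_eqF.
rewrite leq_eqVlt => /orP[/eqP->//|]; rewrite ltnS => le_MN.
apply: le_trans (IHN le_MN) _; rewrite partial_sumS (tailS _ N b_gt1) -[leRHS]addrA lerD2l lerD2r.
have le1 := invS_sum_ge1 R b_gt0 (leq_trans M_gt0 le_MN).
have := block_ge R false N b_gt1; have := block_ge R true N b_gt1.
rewrite addn0 addn1 => leT leF; apply: lerD.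
  by apply: le_trans leF; rewrite ler_wpM2r // invr_ge0 exprn_ge0.
by apply: le_trans leT; rewrite ler_wpM2r // invr_ge0 exprn_ge0.
Qed.

Lemma palindrome_sum_ub (R : realType) b M : (1 < b)%N -> (0 < M)%N ->
  (palindrome_sum R b <= (partial_sum R b M + tail (inv_sum R b 1) b M)%:E)%E.
Proof.
move=> b_gt1 M_gt0; apply: (palindrome_sum_le (M := M)) => // N le_MN.
apply: le_trans (partial_sum_le R b_gt1 (introT andP (conj M_gt0 le_MN))).
by rewrite lerDl tail_ge0 ?inv_sum_ge0.
Qed.

Lemma palindrome_sum_lb (R : realType) b M : (1 < b)%N -> (0 < M)%N ->
  ((partial_sum R b M + tail (invS_sum R b 1) b M)%:E <= palindrome_sum R b)%E.
Proof.
move=> b_gt1 M_gt0; apply/lee_addgt0Pr => e e_gt0.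
(* The tail at N equals c e / b^N, which is at most e as soon as c <= N, because N < b^N. *)
set w := invS_sum R b 1; pose c := w * (b%:R + 1) / (b%:R - 1) / e.
have c_ge0 : 0 <= c.
  rewrite divr_ge0 ?(ltW e_gt0) // divr_ge0 ?subr_ge0 ?ler1n ?(ltnW b_gt1) //.
  by rewrite mulr_ge0 ?invS_sum_ge0 ?addr_ge0.
pose N := maxn M (Num.Def.archi_bound c).
have le_MN : (M <= N)%N by rewrite leq_maxl.
apply: (@le_trans _ _ (partial_sum R b N + e)%:E); last first.
  by rewrite EFinD leeD2r // le_palindrome_sum.
rewrite lee_fin.
apply: le_trans (partial_sum_ge R b_gt1 (introT andP (conj M_gt0 le_MN))) _.
rewrite lerD2l -/w /tail invfM mulrA ler_pdivrMr ?exprn_gt0 ?ltr0n ?(ltnW b_gt1) //.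
rewrite [leRHS]mulrC -ler_pdivrMr // -/c (le_trans (ltW (archi_boundP c_ge0))) //.
rewrite -natrX ler_nat (leq_trans (leq_maxr M _)) // ltnW // ltn_expl //.
Qed.

(** * Numerical comparison of consecutive bases *)

Lemma partial_sum1 (R : realType) b : (1 < b)%N ->
  partial_sum R b 1 = inv_sum R b 0 * (1 + (b%:R + 1)^-1).
Proof.
move=> b_gt1; rewrite /partial_sum big_nat1 !block0 // expr0 expr1 natrD.
by rewrite divr1 mulrDr mulr1.
Qed.

Lemma inv_sum0S (R : realType) b : (0 < b)%N ->
  inv_sum R b.+1 0 = inv_sum R b 0 + b%:R^-1.
Proof. by move=> b_gt0; rewrite /inv_sum !expn0 !expn1 big_nat_recr. Qed.

(** Equality holds at b = 4; afterwards each step adds 1/b <= 1/4, the slope of the right-hand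
    side. *)
Lemma inv_sum0_le (R : realType) b : (4 <= b)%N ->
  inv_sum R b 0 <= (3 * b%:R + 10) / 12.
Proof.
elim: b => // b IHb; rewrite leq_eqVlt => /orP[/eqP <-|].
  rewrite /inv_sum expn0 expn1; do 3 rewrite big_ltn //; rewrite big_geq //; lra.
rewrite ltnS => b_ge4; rewrite inv_sum0S; last exact: leq_trans b_ge4.
have := IHb b_ge4.
have : b%:R^-1 <= 4^-1 :> R.
  by rewrite lef_pV2 ?posrE ?ler_nat // ltr0n (leq_trans _ b_ge4).
lra.
Qed.

(** U_1 for b runs over [b, b^2 - 1] and V_1 for b + 1 over [b + 2, (b + 1)^2]. Passing from the
    first to the second loses 1/b + 1/(b + 1) and gains 2b + 2 terms, each at least 1/(b + 1)^2,
    hence at least 2/(b + 1) in all. *)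
Lemma invS_sum1_succ_ge (R : realType) b : (0 < b)%N ->
  inv_sum R b 1 - (b%:R * (b%:R + 1))^-1 <= invS_sum R b.+1 1.
Proof.
move=> b_gt0; pose f x : R := x%:R^-1.
have b0 : 0 < b%:R :> R by rewrite ltr0n.
have shift : invS_sum R b.+1 1 = \sum_(b.+2 <= y < (b.+1 ^ 2).+1) f y.
  by rewrite big_add1 /= /invS_sum expn1.
have split1 : \sum_(b <= y < (b.+1 ^ 2).+1) f y
    = b%:R^-1 + (b%:R + 1)^-1 + invS_sum R b.+1 1.
  by rewrite big_ltn 1?big_ltn ?shift /f ?natr1 ?addrA //; nia.
have split2 : \sum_(b <= y < (b.+1 ^ 2).+1) f y
    = inv_sum R b 1 + \sum_((b ^ 2)%N <= y < (b ^ 2 + (2 * b + 2))%N) f y.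
  rewrite (big_cat_nat (n := (b ^ 2)%N)) ?expn1 /=; try nia.
  by rewrite /inv_sum expn1; congr (_ + \sum_(_ <= y < _) _); nia.
have : (2 * b + 2)%:R / (b%:R + 1) ^+ 2
    <= \sum_((b ^ 2)%N <= y < (b ^ 2 + (2 * b + 2))%N) f y.
  rewrite mulrC mulr_natr -[X in _ *+ X](addKn (b ^ 2)%N) -sumr_const_nat.
  apply: ler_sum_nat => y yb.
  rewrite natr1 -natrX lef_pV2 ?posrE ?ltr0n ?ler_nat //; nia.
move: split2; rewrite split1 => e12.
have -> : (2 * b + 2)%:R / (b%:R + 1) ^+ 2 = 2 * (b%:R + 1)^-1 :> R.
  by rewrite natrD natrM; field; lra.
have -> : (b%:R * (b%:R + 1))^-1 = b%:R^-1 - (b%:R + 1)^-1 :> R.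
  by field; apply/andP; split; lra.
by lra.
Qed.

Lemma partial_sum_tail_succ (R : realType) b : (4 <= b)%N ->
  partial_sum R b 1 + tail (inv_sum R b 1) b 1
  < partial_sum R b.+1 1 + tail (invS_sum R b.+1 1) b.+1 1.
Proof.
move=> b_ge4; have b_gt0 : (0 < b)%N by lia.
rewrite !partial_sum1 ?inv_sum0S /tail ?expr1; try lia.
have := invS_sum1_succ_ge R b_gt0; have := inv_sum0_le R b_ge4.
have := inv_sum_antitone R 0 b_gt0.
have -> : b.+1%:R = b%:R + 1 :> R by rewrite natr1.
move: (inv_sum R b 0) (inv_sum R b 1) (invS_sum R b.+1 1) => H U V leUH leH leV.
have : 4 <= b%:R :> R by rewrite ler_nat.
move: (b%:R : R) leH leV => x leH leV x_ge4.
set c := x - 4; have c_ge0 : 0 <= c by rewrite subr_ge0.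
set h := (3 * x + 10) / 12 in leH.
set v := U - _ in leV.
have x0 : 0 < x by lra.
have k_ge0 : 0 <= (x + 1 + 1) / ((x + 1 - 1) * (x + 1)).
  by rewrite divr_ge0 ?mulr_ge0; lra.
have leVk := ler_wpM2r k_ge0 leV.
(* Once [V] is replaced by its lower bound [v], both [U] and [H] occur in the difference with
   negative net coefficients (computed in [e1] and [e2]), so each may be replaced by the upper bound
   [h]. *)
have kU : 0 <= (x + 3) / (x * (x ^+ 2 - 1)) by rewrite divr_ge0 ?mulr_ge0; nra.
have leUk := ler_wpM2r kU (le_trans leUH leH).
have kH : 0 <= ((x + 1) * (x + 2))^-1 by rewrite invr_ge0 mulr_ge0; lra.
have leHk := ler_wpM2r kH leH.
(* After clearing denominators, the required inequality is a polynomial in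
   c = b - 4 with positive coefficients. *)
have pos : 0 < (6 * c ^+ 5 + 130 * c ^+ 4 + 1042 * c ^+ 3 + 3662 * c ^+ 2
    + 4784 * c + 144) / (12 * x ^+ 2 * (x + 1) ^+ 2 * (x + 2) * (x - 1)).
  have cX n : 0 <= c ^+ n by rewrite exprn_ge0.
  apply: divr_gt0.
    by have := cX 2; have := cX 3; have := cX 4; have := cX 5; lra.
  by do ! apply: mulr_gt0; rewrite ?exprn_gt0 //; lra.
have n1 : x + 1 != 0 by lra.
have n2 : x + 2 != 0 by lra.
have n3 : x - 1 != 0 by lra.
have n4 : x ^+ 2 - 1 != 0 by rewrite (_ : _ - _ = (x - 1) * (x + 1)) ?mulf_neq0 //; ring.
have n0 : x != 0 by lra.
have e1 : (H + x^-1) * (1 + (x + 1 + 1)^-1) - H * (1 + (x + 1)^-1)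
   = x^-1 * (1 + (x + 2)^-1) - H * ((x + 1) * (x + 2))^-1.
  by field; rewrite n0 n1 n2 -?addrA ?n2.
have e2 : v * ((x + 1 + 1) / ((x + 1 - 1) * (x + 1))) - U * ((x + 1) / ((x - 1) * x))
   = - (U * ((x + 3) / (x * (x ^+ 2 - 1)))) - (x + 2) / (x ^+ 2 * (x + 1) ^+ 2).
  by rewrite /v; field; rewrite n0 n1 n3 n4 ?addrK ?n0.
have e3 : x^-1 * (1 + (x + 2)^-1) - h * ((x + 1) * (x + 2))^-1
   - h * ((x + 3) / (x * (x ^+ 2 - 1))) - (x + 2) / (x ^+ 2 * (x + 1) ^+ 2)
   = (6 * c ^+ 5 + 130 * c ^+ 4 + 1042 * c ^+ 3 + 3662 * c ^+ 2
    + 4784 * c + 144) / (12 * x ^+ 2 * (x + 1) ^+ 2 * (x + 2) * (x - 1)).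
  by rewrite /h /c; field; rewrite n0 n1 n2 n3 n4.
rewrite -e3 in pos.
move: leVk leUk leHk e1 e2 pos; rewrite -!(mulrA U) -!(mulrA V).
clearbody h v.
lra.
Qed.

Lemma palindrome_sum_succ (R : realType) b : (1 < b)%N ->
  (palindrome_sum R b < palindrome_sum R b.+1)%E.
Proof.
move=> b_gt1.
suff [M M_gt0 lt_bb'] : exists2 M, (0 < M)%N &
    partial_sum R b M + tail (inv_sum R b 1) b M
    < partial_sum R b.+1 1 + tail (invS_sum R b.+1 1) b.+1 1.
  apply: le_lt_trans (palindrome_sum_ub R b_gt1 M_gt0) _.
  by apply: lt_le_trans (palindrome_sum_lb R (ltnW b_gt1 : 1 < b.+1)%N (ltn0Sn 0)).
have [b_ge4|b_lt4] := leqP 4 b; first by exists 1%N => //; apply: partial_sum_tail_succ.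
have [->|->] : b = 2%N \/ b = 3%N by lia.
  (* With [M = 1] the upper bound for base 2 (about 2.58) exceeds the lower bound for base 3 (about
     2.54). With [M = 2] the palindromes 5 and 7 enter exactly and the four-digit ones through
     [block_le], giving about 2.51. *)
  exists 2%N => //; rewrite partial_sumS !partial_sum1 //.
  have := block_le R true 1 (isT : (1 < 2)%N).
  have -> : block R 2 false 1 = 5^-1 + 7^-1.
    rewrite /block expn1; do 2 rewrite big_ltn //; rewrite big_geq // addr0.
    by rewrite /mirror /half_length /= !big_ord_recl !big_ord0.
  have -> : tail (inv_sum R 2 1) 2 2 = inv_sum R 2 1 * (3 / 4) by rewrite /tail; field.
  have -> : tail (invS_sum R 3 1) 3 1 = invS_sum R 3 1 * (2 / 3) by rewrite /tail; field.
  have -> : 2%:R ^+ (1 + true) = 4 :> R by ring.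
  rewrite !natr1 /inv_sum /invS_sum !expn0 !expn1.
  rewrite (_ : 2 ^ 2 = 4)%N // (_ : 3 ^ 2 = 9)%N // unlock /=; lra.
exists 1%N => //; rewrite !partial_sum1 //.
have -> : tail (inv_sum R 3 1) 3 1 = inv_sum R 3 1 * (2 / 3) by rewrite /tail; field.
have -> : tail (invS_sum R 4 1) 4 1 = invS_sum R 4 1 * (5 / 12) by rewrite /tail; field.
rewrite !natr1 /inv_sum /invS_sum !expn0 !expn1.
rewrite (_ : 3 ^ 2 = 9)%N // (_ : 4 ^ 2 = 16)%N // unlock /=; lra.
Qed.

Theorem theorem2p3 (R : realType) (b b' : nat) (hb : (2 <= b)%N)
    (hbb' : (b < b')%N) :
  (palindrome_sum R b < palindrome_sum R b')%E.
Proof.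
elim: b' hbb' => // b' IHb'; rewrite ltnS leq_eqVlt => /orP[/eqP <-|lt_bb'].
  exact: palindrome_sum_succ.
apply: lt_trans (IHb' lt_bb') (palindrome_sum_succ R _).
exact: ltn_trans lt_bb'.
Qed.
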